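(* Let $\vec\omega:I\to\mathbb R^3$ be a differentiable vector-valued function on an interval $I\subseteq\mathbb R$ containing $0$, put $\vec\omega_0=\vec\omega(0)$, and let $f:\mathbb R_+^*\to\mathbb R$ possess antiderivatives and be such that the Cauchy problem below with $\vec\omega=\vec 0$ has existence and uniqueness of solutions. Then the Cauchy problem $$\ddot{\vec r}+2\vec\omega\times\dot{\vec r}+\vec\omega\times(\vec\omega\times\vec r)+\dot{\vec\omega}\times\vec r+f(r)\frac{\vec r}{r}=\vec 0,\qquad \vec r(0)=\vec r_0,\quad\dot{\vec r}(0)=\vec v_0$$ admits the following first integrals: $$\frac{\|\dot{\vec r}\|^2}{2}+(\vec\omega,\vec r,\dot{\vec r})+\frac12\|\vec\omega\times\vec r\|^2+\int f(r)\,dr=\mathrm{const.},$$ $$\vec r\times(\dot{\vec r}+\vec\omega\times\vec r)=F_{-\omega}(\vec\Omega_0),\qquad \vec\Omega_0=\vec r_0\times(\vec v_0+\vec\omega_0\times\vec r_0).$$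
   Context: Vectors are in oriented Euclidean three-space, $r=\|\vec r\|$, $\mathbb R_+^*=(0,\infty)$, the dot denotes $d/dt$, $(\vec a,\vec b,\vec c)=\vec a\cdot(\vec b\times\vec c)$ is the scalar triple product, and $\int f(r)\,dr$ denotes a fixed antiderivative of $f$ evaluated at $r=\|\vec r(t)\|$. $\widetilde\omega(t)$ is the skew-symmetric $3\times3$ matrix with $\widetilde\omega(t)\vec x=\vec\omega(t)\times\vec x$. The rotation tensor with angular velocity $-\vec\omega$ is $F_{-\omega}(\vec x)(t)=Q(t)\vec x(t)$, where $Q$ is the unique solution of $\dot Q=-\widetilde\omega Q$, $Q(0)=I_3$; it is applied to constant vectors viewed as constant functions. *)

(* Defs.v *)
From HB Require Import structures.
From mathcomp Require Import all_boot all_order all_algebra.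
From mathcomp Require Import all_classical all_reals all_analysis.
From mathcomp Require Import ring.

Set Implicit Arguments.
Unset Strict Implicit.
Unset Printing Implicit Defensive.

Import Order.TTheory GRing.Theory Num.Theory.
Import numFieldNormedType.Exports.

Local Open Scope classical_set_scope.
Local Open Scope ring_scope.

(** Oriented Euclidean three-space is ['cV[R]_3] with its standard basis. *)

Definition dotprod (R : realType) (u v : 'cV[R]_3) : R :=
  \sum_(i < 3) u i 0 * v i 0.

(* The library norm [`|u|] on matrices is the sup norm: it induces the same
   topology, hence the same derivatives, but is not the Euclidean length. *)
Definition enorm (R : realType) (u : 'cV[R]_3) : R := Num.sqrt (dotprod u u).

(* Additions of indices are in 'I_3, that is, modulo 3. *)
Definition crossprod (R : realType) (u v : 'cV[R]_3) : 'cV[R]_3 :=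
  \col_(i < 3) (u (i + 1) 0 * v (i + 2) 0 - u (i + 2) 0 * v (i + 1) 0).

Notation "u *v w" := (crossprod u w) (at level 40, left associativity).

Definition triple (R : realType) (a b c : 'cV[R]_3) : R := dotprod a (b *v c).

Definition skew_mx (R : realType) (w : 'cV[R]_3) : 'M[R]_3 :=
  \matrix_(i, j) (w *v delta_mx j 0) i 0.

Lemma skew_mxE (R : realType) (w x : 'cV[R]_3) : skew_mx w *m x = w *v x.
Proof.
pose i1 : 'I_3 := lift ord0 ord0; pose i2 : 'I_3 := lift ord0 (lift ord0 ord0).
apply/colP; case=> [[|[|[|//]]] lti];
  rewrite !mxE !big_ord_recl big_ord0 !mxE /= -/i1 -/i2.
- have -> : Ordinal lti + 1 = i1 by exact: val_inj.
  have -> : Ordinal lti + 2 = i2 by exact: val_inj.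
  by ring.
- have -> : Ordinal lti + 1 = i2 by exact: val_inj.
  have -> : Ordinal lti + 2 = ord0 by exact: val_inj.
  by ring.
- have -> : Ordinal lti + 1 = ord0 by exact: val_inj.
  have -> : Ordinal lti + 2 = i1 by exact: val_inj.
  by ring.
Qed.

(** Derivatives relative to a set of times [A]; they are one-sided at an
    endpoint of [A] that belongs to [A]. *)

Definition diff_quot (R : realType) (V : normedModType R) (g : R -> V) (t s : R)
  : V := (s - t)^-1 *: (g s - g t).

Definition derivable_within (R : realType) (V : normedModType R) (A : set R)
    (g : R -> V) (t : R) : Prop :=
  cvg (diff_quot g t s @[s --> within A t^']).

Definition derive_within (R : realType) (V : normedModType R) (A : set R)
    (g : R -> V) (t : R) : V :=
  lim (diff_quot g t s @[s --> within A t^']).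

(* An interval containing 0. It may be open, closed, half-open or unbounded;
   it is not reduced to {0}, so that limits relative to it are unique. *)
Definition time_interval (R : realType) (J : set R) : Prop :=
  [/\ is_interval J, J 0 & exists2 t, J t & t != 0].

Definition antiderivative_pos (R : realType) (f F : R -> R) : Prop :=
  forall x : R, 0 < x -> is_derive x 1 F (f x).

(* [r] solves the Cauchy problem on [J], for an angular velocity [w] given on
   [I]. Since [f] is meaningful on positive reals only, [r] avoids 0 on [J]. *)
Definition cauchy_solution (R : realType) (I : set R) (w : R -> 'cV[R]_3)
    (f : R -> R) (r0 v0 : 'cV[R]_3) (J : set R) (r : R -> 'cV[R]_3) : Prop :=
  let dr := derive_within J r in
  let ddr := derive_within J dr in
  let dw := derive_within I w in
  [/\ forall t, J t -> r t != 0,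
      forall t, J t -> derivable_within J r t,
      forall t, J t -> derivable_within J dr t,
      forall t, J t ->
        ddr t + 2 *: (w t *v dr t) + w t *v (w t *v r t) + dw t *v r t
          + f (enorm (r t)) *: ((enorm (r t))^-1 *: r t) = 0
    & r 0 = r0 /\ dr 0 = v0].

(* Existence is local: motions may collide with the centre in finite time. *)
Definition inertial_well_posed (R : realType) (f : R -> R) : Prop :=
  forall r0 v0 : 'cV[R]_3, r0 != 0 ->
    (exists J r, [/\ time_interval J, nbhs (0 : R) J
       & cauchy_solution setT (fun=> 0) f r0 v0 J r]) /\
    (forall J r1 r2, time_interval J ->
       cauchy_solution setT (fun=> 0) f r0 v0 J r1 ->
       cauchy_solution setT (fun=> 0) f r0 v0 J r2 ->
       forall t, J t -> r1 t = r2 t).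

Definition rotation_ivp (R : realType) (I : set R) (w : R -> 'cV[R]_3)
    (Q : R -> 'M[R]_3) : Prop :=
  Q 0 = 1%:M /\
  forall t, I t -> derivable_within I Q t /\
                   derive_within I Q t = - skew_mx (w t) *m Q t.

(* For [w] continuous on the interval [I] the linear problem [rotation_ivp] has
   exactly one solution on [I]; [get] selects it (its values outside of [I] are
   irrelevant). *)
Definition rotation_mx_neg (R : realType) (I : set R) (w : R -> 'cV[R]_3)
  : R -> 'M[R]_3 := get [set Q | rotation_ivp I w Q].

(* The rotation tensor with angular velocity [- w], acting on vector-valued
   functions of time. *)
Definition rotation_tensor_neg (R : realType) (I : set R) (w : R -> 'cV[R]_3)
    (x : R -> 'cV[R]_3) : R -> 'cV[R]_3 :=
  fun t => rotation_mx_neg I w t *m x t.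

(* Main.v *)
Require Import Defs.
From mathcomp Require Import all_boot all_order all_algebra.
From mathcomp Require Import all_classical all_reals all_analysis.
From mathcomp Require Import ring lra.

Import Order.TTheory GRing.Theory Num.Theory.
Import numFieldNormedType.Exports.

Local Open Scope classical_set_scope.
Local Open Scope ring_scope.

(** Let [u = dr + omega *v r], the velocity seen from the inertial frame, in
    rotating coordinates. The equation of motion says
    [u' = - omega *v u - (f(r) / r) *: r] ([Du] in the main proof), and both
    first integrals follow from it.

    The left-hand side of the first one is [dotprod u u / 2 + F (enorm r)]. As
    [omega *v u] is orthogonal to [u] and [omega *v r] to [r], its derivative is
    [- (f(r) / r) * dotprod dr r + f(r) * (dotprod r dr / r) = 0].

    For the second one, the Jacobi identity gives [L' = - omega *v L] for
    [L = r *v u]. The vector [Q *m Omega0], where [Q] is the rotation matrix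
    with angular velocity [- omega], solves the same equation with the same value
    at 0. The difference [M] of the two keeps a constant length, because
    [omega *v M] is orthogonal to [M] ([rotating_flow_unique]); so it is zero.

    The analytic part is the existence of [Q] on the whole interval, which may
    be open, closed or unbounded: linear systems [X' = A X] with coefficients
    continuous on an interval have global solutions ([linear_ode_solution]).
    These are limits of Picard iterates. A weight built from exponentials of a
    primitive of the size of [A] makes the Picard operator halve distances
    ([picard_contraction]), so that a single sequence of iterates converges on
    the whole interval, even where [A] is unbounded. All derivatives are relative
    to the interval of times; the mean value theorem carries over to them
    ([MVT_within]), since at an interior point they are ordinary derivatives
    ([is_derive_within_oo]). *)

(** * Derivatives relative to a set of times *)

Definition is_derive_within {R : realType} {V : normedModType R}
    (A : set R) (g : R -> V) (t : R) (l : V) : Prop :=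
  diff_quot g t s @[s --> within A t^'] --> l.

Lemma is_derive_within_ext {R : realType} {V : normedModType R} {A : set R}
    {g q : R -> V} {t : R} {l : V} :
  diff_quot g t =1 q -> q s @[s --> within A t^'] --> l ->
  is_derive_within A g t l.
Proof. by rewrite /is_derive_within => /funext ->. Qed.

Lemma is_derive_withinS {R : realType} {V : normedModType R} {A B : set R}
    {g : R -> V} {t : R} {l : V} :
  A `<=` B -> is_derive_within B g t l -> is_derive_within A g t l.
Proof.
by move=> AB; apply: cvg_trans; apply: cvg_app; exact: within_subset.
Qed.

Lemma diff_quotK {R : realType} {V : normedModType R} (g : R -> V) (t s : R) :
  g s = g t + (s - t) *: diff_quot g t s.
Proof.
have [->|st] := eqVneq s t; first by rewrite subrr scale0r addr0.
by rewrite scalerA divff ?subr_eq0// scale1r addrC subrK.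
Qed.

Lemma is_derive_within_cvg {R : realType} {V : normedModType R} {A : set R}
    {g : R -> V} {t : R} {l : V} :
  is_derive_within A g t l -> g s @[s --> within A t^'] --> g t.
Proof.
move=> dg.
have st0 : s - t @[s --> within A t^'] --> (0 : R).
  have st : s @[s --> within A t^'] --> t.
    by move=> U /nbhs_dnbhs Ut; exact: cvg_within Ut.
  by rewrite -(subrr t); exact: cvgB st (cvg_cst t).
rewrite -[X in _ --> X]addr0 -(scale0r l).
rewrite [X in X @ _](_ : _ = fun s => g t + (s - t) *: diff_quot g t s).
  exact: cvgD (cvg_cst (g t)) (cvgZ st0 dg).
by apply/funext => s; exact: diff_quotK.
Qed.

Lemma cvg_within_dnbhs {R : realType} {V : normedModType R} {A : set R}
    {g : R -> V} {t : R} :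
  g s @[s --> within A t^'] --> g t -> g s @[s --> within A (nbhs t)] --> g t.
Proof.
move=> gt U Ut.
have : \forall s \near t, s != t -> A s -> U (g s) by exact: gt.
rewrite /within /=; apply: filterS => s US As.
have [->|st] := eqVneq s t; last exact: US.
exact: nbhs_singleton Ut.
Qed.

Lemma derive_within_continuous {R : realType} {V : normedModType R} {A : set R}
    {g g' : R -> V} :
  (forall t, A t -> is_derive_within A g t (g' t)) -> {within A, continuous g}.
Proof.
move=> dg; apply/subspace_continuousP => t At; apply: cvg_within_dnbhs.
exact: is_derive_within_cvg (dg t At).
Qed.

Lemma is_derive_within_cst {R : realType} {V : normedModType R} (A : set R)
    (c : V) (t : R) : is_derive_within A (fun=> c) t 0.
Proof.
rewrite /is_derive_within [X in X @ _](_ : _ = fun=> 0); first exact: cvg_cst.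
by apply/funext => s; rewrite /diff_quot subrr scaler0.
Qed.

Lemma is_derive_withinD {R : realType} {V : normedModType R} {A : set R}
    {g h : R -> V} {t : R} {k l : V} :
  is_derive_within A g t k -> is_derive_within A h t l ->
  is_derive_within A (fun s => g s + h s) t (k + l).
Proof.
move=> dg dh; apply: is_derive_within_ext (cvgD dg dh) => s /=.
by rewrite -scalerDr addrACA -opprD.
Qed.

Lemma is_derive_withinM {R : realType} {A : set R} {g h : R -> R} {t k l : R} :
  is_derive_within A g t k -> is_derive_within A h t l ->
  is_derive_within A (fun s => g s * h s) t (k * h t + g t * l).
Proof.
move=> dg dh; apply: is_derive_within_ext
  (cvgD (cvgM dg (is_derive_within_cvg dh)) (cvgM (cvg_cst (g t)) dh)) => s /=.
by rewrite /diff_quot /GRing.scale /=; ring.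
Qed.

Lemma is_derive_withinMl {R : realType} {A : set R} (c : R) {g : R -> R}
    {t l : R} :
  is_derive_within A g t l -> is_derive_within A (fun s => c * g s) t (c * l).
Proof.
move=> dg; rewrite -[X in is_derive_within _ _ _ X]add0r -(mul0r (g t)).
exact: is_derive_withinM (is_derive_within_cst A c t) dg.
Qed.

Lemma is_derive_withinB {R : realType} {A : set R} {g h : R -> R} {t k l : R} :
  is_derive_within A g t k -> is_derive_within A h t l ->
  is_derive_within A (fun s => g s - h s) t (k - l).
Proof.
move=> dg dh; apply: is_derive_within_ext (cvgB dg dh) => s /=.
by rewrite !fctE /diff_quot /GRing.scale /=; ring.
Qed.

Lemma is_derive_within_sum {R : realType} {n : nat} {A : set R}
    {g : 'I_n -> R -> R} {t : R} {l : 'I_n -> R} :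
  (forall i, is_derive_within A (g i) t (l i)) ->
  is_derive_within A (fun s => \sum_i g i s) t (\sum_i l i).
Proof.
elim: n g l => [|n IH] g l dg.
  under eq_fun do rewrite big_ord0.
  by rewrite big_ord0; exact: is_derive_within_cst.
under eq_fun do rewrite big_ord_recr.
by rewrite big_ord_recr; apply: is_derive_withinD (dg _); exact: IH.
Qed.

(** Caratheodory's slope function [q] of [F] at [g t] is continuous there, and
    the difference quotient of [F \o g] is [q (g s)] times that of [g], even at
    the times where [g s = g t]. *)
Lemma is_derive_within_comp {R : realType} {A : set R} {F g : R -> R}
    {t k l : R} :
  is_derive (g t) 1 F k -> is_derive_within A g t l ->
  is_derive_within A (fun s => F (g s)) t (k * l).
Proof.
move=> /is_derive1_caratheodory[q [Fq cq <-]] dg.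
have qg : q (g s) @[s --> within A t^'] --> q (g t).
  exact: cvg_comp (is_derive_within_cvg dg) cq.
apply: is_derive_within_ext (cvgM qg dg) => s /=.
by rewrite /diff_quot /GRing.scale/= Fq; ring.
Qed.

Lemma is_derive_within_id {R : realType} (A : set R) (t : R) :
  is_derive_within A id t 1.
Proof.
have : \forall s \near t, s != t -> A s -> diff_quot id t s = 1.
  near=> s => st As.
  by rewrite /diff_quot /GRing.scale/= mulVf// subr_eq0.
move=> e U /nbhs_singleton U1.
rewrite /= /within /dnbhs /within /=; move: e; apply: filterS => s e st As.
by rewrite /= e.
Unshelve. all: by end_near. Qed.

Lemma is_derive_within_derive {R : realType} (A : set R) {g : R -> R}
    {t l : R} :
  is_derive t 1 g l -> is_derive_within A g t l.
Proof.
move=> dg; have := is_derive_within_comp dg (is_derive_within_id A t).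
by rewrite mulr1.
Qed.

Lemma is_derive_within_oo {R : realType} {a b c : R} {g : R -> R} {l : R} :
  a < c < b -> is_derive_within `]a, b[ g c l -> is_derive c 1 g l.
Proof.
move=> acb dg.
have cvgl : h^-1 *: ((g \o shift c) (h *: 1) - g c) @[h --> 0^'] --> l.
  move=> U /dg Uc.
  have {}Uc : \forall s \near c, s != c -> U (diff_quot g c s).
    have cab : \forall s \near c, s \in `]a, b[.
      by apply: near_in_itvoo; rewrite in_itv.
    have {}Uc : \forall s \near c,
        s != c -> s \in `]a, b[ -> U (diff_quot g c s) by exact: Uc.
    by move: cab Uc; apply: filterS2 => s sab Us sc; exact: Us.
  have c0 : h + c @[h --> (0 : R)] --> c.
    by rewrite -{2}[c]add0r; apply: cvgD => //; exact: cvg_cst.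
  have : \forall h \near 0, h != 0 ->
      U (h^-1 *: ((g \o shift c) (h *: 1) - g c)).
    have : \forall h \near 0, h + c != c -> U (diff_quot g c (h + c)).
      exact: (c0 _ Uc).
    apply: filterS => h /= Uh h0.
    by move: Uh; rewrite -subr_eq0 /diff_quot addrK [h *: 1]mulr1; exact.
  exact.
by apply: DeriveDef; [exact: cvgP cvgl|exact: cvg_lim cvgl].
Qed.

Lemma MVT_within {R : realType} {J : set R} {g g' : R -> R} {s t : R} :
  is_interval J -> (forall x, J x -> is_derive_within J g x (g' x)) ->
  J s -> J t -> s < t -> exists2 c, s < c < t & g t - g s = g' c * (t - s).
Proof.
move=> iJ dg Js Jt st.
have stJ : `[s, t] `<=` J.
  by move=> x /=; rewrite in_itv/= => xst; exact: iJ Js Jt _ xst.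
have ooJ : `]s, t[ `<=` J.
  by apply: subset_trans stJ; exact: subset_itv_oo_cc.
have [||c cst ->] := @MVT _ g g' s t st.
- move=> x xst; apply: (@is_derive_within_oo _ s t).
    by rewrite in_itv in xst.
  by apply: is_derive_withinS (dg _ _) => //; exact: ooJ.
- exact: continuous_subspaceW stJ (derive_within_continuous dg).
- by exists c => //; rewrite in_itv in cst.
Qed.

(** Unlike the monotonicity of [is_derive_withinS], which only shrinks
    the set, this lets a derivative computed on a compact subinterval serve on
    the whole interval. *)
Lemma is_derive_within_near {R : realType} {V : normedModType R} {A B : set R}
    {g : R -> V} {t : R} {l : V} :
  (\forall s \near t, A s -> B s) ->
  is_derive_within B g t l -> is_derive_within A g t l.
Proof.
move=> AB dg U /dg Ul.
have {}Ul : \forall s \near t, s != t -> B s -> U (diff_quot g t s).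
  exact: Ul.
have : \forall s \near t, s != t -> A s -> U (diff_quot g t s).
  by move: AB Ul; apply: filterS2 => s AB Us st /AB; exact: Us.
exact.
Qed.

Lemma derive_within0_cst {R : realType} {J : set R} {g : R -> R} {s t : R} :
  is_interval J -> (forall x, J x -> is_derive_within J g x 0) ->
  J s -> J t -> g s = g t.
Proof.
move=> iJ dg; wlog st : s t / s < t.
  move=> H Js Jt; have [st|ts|->//] := ltgtP s t; first exact: H.
  by rewrite (H t s).
move=> Js Jt; have [c _] := MVT_within (g' := fun=> 0) iJ dg Js Jt st.
by rewrite mul0r => /eqP; rewrite subr_eq0 => /eqP.
Qed.

(** By the mean value theorem, [g - h] and [g + h] are both nondecreasing. The
    absolute value on the right lets [t] lie on either side of [s]. *)
Lemma mean_value_bound {R : realType} {I : set R} {h g h' g' : R -> R}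
    {s t : R} :
  is_interval I ->
  (forall x, I x -> is_derive_within I h x (h' x)) ->
  (forall x, I x -> is_derive_within I g x (g' x)) ->
  (forall x, I x -> `|h' x| <= g' x) ->
  I s -> I t -> `|h t - h s| <= `|g t - g s|.
Proof.
move=> iI dh dg hg; wlog st : s t / s < t.
  move=> H Is It; have [st|ts|->] := ltgtP s t; first exact: H.
    by rewrite distrC (distrC (g t)); exact: H.
  by rewrite !subrr.
move=> Is It; rewrite [leRHS]ger0_norm; last first.
  have [c /andP[sc ct] ->] := MVT_within iI dg Is It st.
  have Ic : I c by apply: iI Is It _ _; rewrite !ltW.
  by rewrite mulr_ge0 ?subr_ge0 ?(ltW st)// (le_trans _ (hg c Ic)).
have dM x : I x -> is_derive_within I (fun y => g y - h y) x (g' x - h' x).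
  by move=> Ix; exact: is_derive_withinB (dg x Ix) (dh x Ix).
have dP x : I x -> is_derive_within I (fun y => g y + h y) x (g' x + h' x).
  by move=> Ix; exact: is_derive_withinD (dg x Ix) (dh x Ix).
have [c /andP[sc ct] Ec] := MVT_within iI dM Is It st.
have [d /andP[sd dt] Ed] := MVT_within iI dP Is It st.
have Ic : I c by apply: iI Is It _ _; rewrite !ltW.
have Id : I d by apply: iI Is It _ _; rewrite !ltW.
have {}Ec : 0 <= (g t - h t) - (g s - h s).
  rewrite Ec mulr_ge0 ?subr_ge0 ?(ltW st)//.
  exact: le_trans (ler_norm _) (hg c Ic).
have {}Ed : 0 <= (g t + h t) - (g s + h s).
  rewrite Ed mulr_ge0 ?subr_ge0 ?(ltW st)// -lerBlDr sub0r.
  by apply: le_trans (hg d Id); rewrite -normrN; exact: ler_norm.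
by rewrite ler_norml; apply/andP; split; lra.
Qed.

Lemma is_derive_within_mxP {R : realType} {m n : nat} {A : set R}
    {M : R -> 'M[R]_(m.+1, n.+1)} {t : R} {D : 'M[R]_(m.+1, n.+1)} :
  is_derive_within A M t D <->
  forall i j, is_derive_within A (fun s => M s i j) t (D i j).
Proof.
have qE i j : diff_quot (fun s => M s i j) t =1 fun s => diff_quot M t s i j.
  by move=> s; rewrite /diff_quot !mxE.
split=> [dM i j|dM].
  apply: is_derive_within_ext (qE i j) _.
  exact: cvg_comp dM (@coord_continuous _ _ _ i j _).
apply/cvg_ballP => e e0.
have H : \forall s \near within A t^',
    forall p : 'I_m.+1 * 'I_n.+1, ball (D p.1 p.2) e (diff_quot M t s p.1 p.2).
  apply: filter_forall => p.
  have /cvg_ballP/(_ e e0) := dM p.1 p.2.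
  by apply: filterS => s; rewrite qE.
by move: H; apply: filterS => s H; split=> // i j; exact: (H (i, j)).
Qed.

Lemma derivable_withinP {R : realType} {V : normedModType R} {A : set R}
    {g : R -> V} {t : R} :
  derivable_within A g t -> is_derive_within A g t (derive_within A g t).
Proof. exact. Qed.

(** A nontrivial interval accumulates at each of its points: this is what makes
    a relative derivative unique. *)
Lemma time_interval_within_proper {R : realType} {A : set R} {t : R} :
  time_interval A -> A t -> ProperFilter (within A t^').
Proof.
move=> [iA A0 [u Au u0]] At.
have [v Av vt] : exists2 v, A v & v != t.
  have [t0|t0] := eqVneq t 0; first by exists u => //; rewrite t0.
  by exists 0 => //; rewrite eq_sym.
apply: Build_ProperFilter_ex => B Bt.
have {}Bt : \forall s \near t, s != t -> A s -> B s by exact: Bt.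
have [tv|tv] : t < v \/ v < t.
  by move: vt; rewrite neq_lt => /orP[]; [right|left].
- have tB : \forall s \near t^'+, s != t -> A s -> B s by exact: cvg_within Bt.
  have tA : \forall s \near t^'+, t < s by exact: nbhs_right_gt.
  have sv : \forall s \near t^'+, s < v by exact: nbhs_right_lt.
  near (t^'+) => s; exists s.
  have ts : t < s by near: s.
  have sv' : s < v by near: s.
  have : s != t -> A s -> B s by near: s.
  by apply; [rewrite gt_eqF|apply: iA At Av _ _; rewrite !ltW].
- have tB : \forall s \near t^'-, s != t -> A s -> B s by exact: cvg_within Bt.
  have tA : \forall s \near t^'-, s < t by exact: nbhs_left_lt.
  have sv : \forall s \near t^'-, v < s by exact: nbhs_left_gt.
  near (t^'-) => s; exists s.
  have ts : s < t by near: s.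
  have sv' : v < s by near: s.
  have : s != t -> A s -> B s by near: s.
  by apply; [rewrite lt_eqF|apply: iA Av At _ _; rewrite !ltW].
Unshelve. all: by end_near. Qed.

Lemma derive_withinE {R : realType} {V : normedModType R} {A : set R}
    {g : R -> V} {t : R} {l : V} :
  time_interval A -> A t -> is_derive_within A g t l ->
  derivable_within A g t /\ derive_within A g t = l.
Proof.
move=> tA At dg; have pF := time_interval_within_proper tA At.
by split; [exact: cvgP dg|exact: cvg_lim dg].
Qed.

(** * Primitives on an interval *)

(** This reduces relative derivatives on [I] to compact subintervals. When [t] is
    an endpoint of [I], [t] is also the endpoint of [`[a, b]] on that side. *)
Lemma interval_relative_nbhs {R : realType} {I : set R} {t : R} :
  I 0 -> I t ->
  exists a b, [/\ I a, I b, a <= 0 <= b, a <= t <= b &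
    \forall s \near t, I s -> a <= s <= b].
Proof.
move=> I0 It.
have [a [Ia a0 at_ an]] : exists a, [/\ I a, a <= 0, a <= t &
    \forall s \near t, I s -> a <= s].
  have [[u [Iu ut]]|noI] := pselect (exists u, I u /\ u < t).
    exists (Num.min u 0); split.
    - by rewrite /Num.min; case: ifP.
    - by rewrite ge_min lexx orbT.
    - by rewrite ge_min (ltW ut).
    - near=> s => _; rewrite ge_min; apply/orP; left; apply: ltW.
      by near: s; exact: lt_nbhsr.
  have Imin u : I u -> t <= u.
    by move=> Iu; rewrite leNgt; apply/negP => ut; apply: noI; exists u.
  by exists t; split=> //; [exact: Imin|near=> s; exact: Imin].
have [b [Ib b0 tb bn]] : exists b, [/\ I b, 0 <= b, t <= b &
    \forall s \near t, I s -> s <= b].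
  have [[u [Iu tu]]|noI] := pselect (exists u, I u /\ t < u).
    exists (Num.max u 0); split.
    - by rewrite /Num.max; case: ifP.
    - by rewrite le_max lexx orbT.
    - by rewrite le_max (ltW tu).
    - near=> s => _; rewrite le_max; apply/orP; left; apply: ltW.
      by near: s; exact: lt_nbhsl.
  have Imax u : I u -> u <= t.
    by move=> Iu; rewrite leNgt; apply/negP => tu; apply: noI; exists u.
  by exists t; split=> //; [exact: Imax|near=> s; exact: Imax].
exists a, b; split=> //; [exact/andP|exact/andP|].
by move: an bn; apply: filterS2 => s sa sb Is; rewrite sa ?sb.
Unshelve. all: by end_near. Qed.

Lemma ex_primitive_oo {R : realType} {g : R -> R} (a b : R) :
  continuous g ->
  exists G : R -> R, forall x, a < x < b -> is_derive x 1 G (g x).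
Proof.
move=> cg.
exists (fun x => \int[@lebesgue_measure R]_(t in `[a, x]) g t)%R.
move=> x /andP[ax xb].
have ig : (@lebesgue_measure R).-integrable `[a, b] (EFin \o g).
  apply: continuous_compact_integrable; first exact: segment_compact.
  exact: continuous_subspaceT.
have [dG G'] := @continuous_FTC1_closed R g a x b xb ig ax (cg x).
by apply: DeriveDef; [exact: dG|rewrite -derive1E; exact: G'].
Qed.

(** Clamping the variable to [`[a, b]] extends the restriction of [g] to a
    continuous function on the line, to which the fundamental theorem of
    calculus applies without one-sided cases at [a] and [b]. *)
Lemma ex_primitive_cc {R : realType} {I : set R} {g : R -> R} {a b : R} :
  is_interval I -> {within I, continuous g} -> I a -> I b -> a <= 0 <= b ->
  exists G : R -> R, G 0 = 0 /\
    forall x, a <= x <= b -> is_derive_within `[a, b] G x (g x).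
Proof.
move=> iI cg Ia Ib /andP[a0 b0].
pose c x := Num.max a (Num.min x b).
have cab x : a <= c x <= b.
  by rewrite /c le_max lexx/= ge_max (le_trans a0 b0) ge_min lexx orbT.
have cI x : I (c x) by exact: iI Ia Ib _ (cab x).
have cc : continuous c.
  move=> x.
  apply: (@continuous_max R R (fun=> a) (fun x => Num.min x b)) => //.
    exact: cvg_cst.
  apply: (@continuous_min R R id (fun=> b)) => //.
  exact: cvg_cst.
have cgc : continuous (g \o c).
  move=> x U /((subspace_continuousP _ _).1 cg (c x) (cI x)) gU.
  have {}gU : \forall y \near c x, I y -> U (g y) by exact: gU.
  have : \forall y \near x, I (c y) -> U (g (c y)) by exact: (cc x _ gU).
  by apply: filterS => y; exact.
have [G dG] := ex_primitive_oo (a - 1) (b + 1) cgc.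
exists (fun x => G x - G 0); split; first by rewrite subrr.
move=> x /andP[ax xb].
rewrite -[g x]subr0; apply: is_derive_withinB; last exact: is_derive_within_cst.
apply: is_derive_within_derive.
have <- : (g \o c) x = g x by rewrite /= /c (min_idPl xb) (max_idPr ax).
by apply: dG; apply/andP; split; lra.
Qed.

(** The primitives of [ex_primitive_cc] that vanish at 0 agree wherever two of
    them are defined. So the value at [t] may be read off the primitive on the
    interval between 0 and [t], and near [t] it is that of a single primitive. *)
Lemma ex_primitive {R : realType} {I : set R} {g : R -> R} :
  is_interval I -> I 0 -> {within I, continuous g} ->
  exists G : R -> R, G 0 = 0 /\ forall t, I t -> is_derive_within I G t (g t).
Proof.
move=> iI I0 cg.
have prim p : {G : R -> R | I p.1 -> I p.2 -> p.1 <= 0 <= p.2 -> G 0 = 0 /\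
    forall x, p.1 <= x <= p.2 -> is_derive_within `[p.1, p.2] G x (g x)}.
  apply: cid.
  have [[Ia Ib ab]|nab] := pselect [/\ I p.1, I p.2 & p.1 <= 0 <= p.2].
    by have [G HG] := ex_primitive_cc iI cg Ia Ib ab; exists G.
  by exists (fun=> 0) => Ia Ib ab; exfalso; apply: nab.
pose P a b := sval (prim (a, b)).
have PP a b : I a -> I b -> a <= 0 <= b -> P a b 0 = 0 /\
    forall x, a <= x <= b -> is_derive_within `[a, b] (P a b) x (g x).
  exact: (svalP (prim (a, b))).
have PE a b t : I a -> I b -> a <= 0 <= b -> a <= t <= b ->
    P (Num.min 0 t) (Num.max 0 t) t = P a b t.
  move=> Ia Ib ab abt.
  have It : I t by exact: iI Ia Ib _ abt.
  set u := Num.min 0 t; set v := Num.max 0 t.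
  have Iu : I u by rewrite /u /Num.min; case: ifP.
  have Iv : I v by rewrite /v /Num.max; case: ifP.
  have uv : u <= 0 <= v by rewrite ge_min le_max lexx.
  have [P0 dP] := PP u v Iu Iv uv.
  have [Q0 dQ] := PP a b Ia Ib ab.
  have uvab : `[u, v] `<=` `[a, b].
    move: ab abt => /andP[a0 b0] /andP[at_ tb].
    apply: subset_itvScc; rewrite bnd_simp.
      by rewrite le_min a0.
    by rewrite ge_max b0.
  have uvt : u <= t <= v by rewrite ge_min le_max lexx !orbT.
  suff : P u v t - P a b t = P u v 0 - P a b 0.
    by rewrite P0 Q0 subrr => /eqP; rewrite subr_eq0 => /eqP.
  apply: (derive_within0_cst (J := `[u, v]) (g := fun x => P u v x - P a b x)).
  - exact: interval_is_interval.
  - move=> x uvx; rewrite -(subrr (g x)).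
    apply: is_derive_withinB; first by apply: dP; rewrite /= in_itv in uvx.
    apply: (is_derive_withinS uvab); apply: dQ.
    by have := uvab _ uvx; rewrite /= in_itv.
  - by rewrite /= in_itv.
  - by rewrite /= in_itv.
exists (fun t => P (Num.min 0 t) (Num.max 0 t) t); split.
  by rewrite minxx maxxx; apply: (PP 0 0 I0 I0 _).1; rewrite lexx.
move=> t It; have [a [b [Ia Ib ab abt nt]]] := interval_relative_nbhs I0 It.
have [_ /(_ t abt) dP] := PP a b Ia Ib ab.
have {}dP := is_derive_within_near (A := I) _ dP.
have {}dP : is_derive_within I (P a b) t (g t).
  by apply: dP; move: nt; apply: filterS => s st /st; rewrite /= in_itv.
move=> U /dP Ul.
have {}Ul : \forall s \near t, s != t -> I s -> U (diff_quot (P a b) t s).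
  exact: Ul.
have : \forall s \near t, s != t -> I s ->
    U (diff_quot (fun t => P (Num.min 0 t) (Num.max 0 t) t) t s).
  move: nt Ul; apply: filterS2 => s abs Us st Is.
  by rewrite /diff_quot (PE a b s) ?(PE a b t) ?abs//; exact: Us.
exact.
Qed.

(** * Existence for linear systems *)

(** The sequence [u n - C / 2 ^+ n] is nondecreasing, [u n + C / 2 ^+ n] is
    nonincreasing, and every term of the former is below every term of the
    latter: the supremum of the former is the limit. *)
Lemma geometric_steps_limit {R : realType} {u : nat -> R} {C : R} :
  (forall n, `|u n.+1 - u n| <= C / 2 / 2 ^+ n) ->
  exists l, forall n, `|l - u n| <= C / 2 ^+ n.
Proof.
move=> du.
have C0 : 0 <= C.
  by have := le_trans (normr_ge0 _) (du 0); rewrite expr0; lra.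
have halfS n : C / 2 ^+ n.+1 = C / 2 / 2 ^+ n :> R.
  by rewrite exprS; field; rewrite expf_neq0.
have halfD n : C / 2 ^+ n = C / 2 / 2 ^+ n + C / 2 / 2 ^+ n :> R.
  by field; rewrite expf_neq0.
pose a n := u n - C / 2 ^+ n; pose b n := u n + C / 2 ^+ n.
have aM : nondecreasing_seq a.
  apply/nondecreasing_seqP => n; have := du n.
  by rewrite /a halfS ler_norml (halfD n) => /andP[]; lra.
have bM : nonincreasing_seq b.
  apply/nonincreasing_seqP => n; have := du n.
  by rewrite /b halfS ler_norml (halfD n) => /andP[]; lra.
have ab n m : a n <= b m.
  apply: le_trans (aM _ _ (leq_maxl n m)) (le_trans _ (bM _ _ (leq_maxr n m))).
  rewrite /a /b lerD2l ge0_cp// divr_ge0//.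
have ubb m : ubound (range a) (b m) by move=> _ [n _ <-]; exact: ab.
exists (sup (range a)) => n; rewrite ler_distl; apply/andP; split.
  by apply: ub_le_sup; [exists (b 0); exact: ubb|exists n].
by apply: ge_sup; [exists (a 0), 0|exact: ubb].
Qed.

Lemma div_exp2_lt {R : realType} (C e : R) :
  0 < e -> exists n, C / 2 ^+ n < e.
Proof.
move=> e0; exists (Num.bound `|C / e|); set n := Num.bound _.
rewrite ltr_pdivrMr ?exprn_gt0// mulrC -ltr_pdivrMr//.
apply: le_lt_trans (ler_norm _) _.
apply: lt_le_trans (archi_boundP (normr_ge0 _)) _.
by rewrite -natrX ler_nat; exact/ltnW/ltn_expl.
Qed.

(** The convergence is uniform only where the weight [w] is bounded; as [w] is
    continuous, it is bounded near each point, by [w t + 1]. *)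
Lemma within_continuous_geometric_limit {R : realType} {I : set R}
    {x : nat -> R -> R} {q w : R -> R} {C : R} :
  (forall n, {within I, continuous (x n)}) -> {within I, continuous w} ->
  (forall n t, I t -> `|q t - x n t| <= C / 2 ^+ n * w t) -> 0 <= C ->
  {within I, continuous q}.
Proof.
move=> cx cw qx C0; apply/subspace_continuousP => t It.
apply/cvgrPdist_lt => e e0.
have e3 : 0 < e / 3 by rewrite divr_gt0.
have [n Cn] := div_exp2_lt (C * (w t + 1)) _ e3.
have /cvgrPdist_lt/(_ _ e3) xt := (subspace_continuousP _ _).1 (cx n) t It.
have /cvgrPdist_lt/(_ 1 ltr01) wt := (subspace_continuousP _ _).1 cw t It.
have Is : \forall s \near within I (nbhs t), I s by exact: within_nbhsW.
near=> s.
have Js : I s by near: s.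
have xs : `|x n t - x n s| < e / 3 by near: s.
have ws : `|w t - w s| < 1 by near: s.
have C2 : 0 <= C / 2 ^+ n by rewrite divr_ge0.
have qt : `|q t - x n t| < e / 3.
  apply: le_lt_trans (qx n t It) (le_lt_trans _ Cn).
  by rewrite [leRHS]mulrAC ler_wpM2l// lerDl.
have qs : `|q s - x n s| < e / 3.
  apply: le_lt_trans (qx n s Js) (le_lt_trans _ Cn).
  rewrite [leRHS]mulrAC ler_wpM2l//.
  by move: ws; rewrite ltr_norml => /andP[]; lra.
suff: `|q t - q s| < e by [].
move: xs qt qs; rewrite !ltr_norml => /andP[? ?] /andP[? ?] /andP[? ?].
by apply/andP; split; lra.
Unshelve. all: by end_near. Qed.

Lemma within_continuousM {R : realType} {I : set R} {g h : R -> R} :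
  {within I, continuous g} -> {within I, continuous h} ->
  {within I, continuous (fun t => g t * h t)}.
Proof. by move=> cg ch t; apply: continuousM; [exact: cg|exact: ch]. Qed.

Lemma within_continuous_sum {R : realType} {I : set R} {n : nat}
    {g : 'I_n -> R -> R} :
  (forall i, {within I, continuous (g i)}) ->
  {within I, continuous (fun t => \sum_i g i t)}.
Proof.
elim: n g => [|n IH] g cg.
  under eq_fun do rewrite big_ord0.
  by move=> t; exact: cvg_cst.
under eq_fun do rewrite big_ord_recr.
move=> t; apply: continuousD; last exact: cg.
by apply: IH => i; exact: cg.
Qed.

Lemma within_continuous_mulmx {R : realType} {I : set R} {m n p : nat}
    {A : R -> 'M[R]_(m, n)} {B : R -> 'M[R]_(n, p)} :
  (forall i j, {within I, continuous (fun t => A t i j)}) ->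
  (forall i j, {within I, continuous (fun t => B t i j)}) ->
  forall i j, {within I, continuous (fun t => (A t *m B t) i j)}.
Proof.
move=> cA cB i j; under eq_fun do rewrite mxE.
by apply: within_continuous_sum => k; exact: within_continuousM.
Qed.

(** The continuity of [B] is asked for after [G], so that the primitive can be
    chosen as a total function of [B] and iterated. *)
Lemma ex_primitive_mx {R : realType} {I : set R} {m n : nat}
    (X0 : 'M[R]_(m, n)) (B : R -> 'M[R]_(m, n)) :
  is_interval I -> I 0 ->
  exists G : R -> 'M[R]_(m, n),
    (forall i j, {within I, continuous (fun t => B t i j)}) ->
    G 0 = X0 /\ forall t, I t -> forall i j,
      is_derive_within I (fun s => G s i j) t (B t i j).
Proof.
move=> iI I0.
have [cB|ncB] := pselect
  (forall i j, {within I, continuous (fun t => B t i j)}); last first.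
  by exists (fun=> 0).
have prim (p : 'I_m * 'I_n) : {g : R -> R | g 0 = 0 /\
    forall t, I t -> is_derive_within I g t (B t p.1 p.2)}.
  by apply: cid; exact: ex_primitive iI I0 (cB _ _).
exists (fun t => \matrix_(i, j) (X0 i j + sval (prim (i, j)) t)) => _; split.
  by apply/matrixP => i j; rewrite mxE (svalP (prim (i, j))).1 addr0.
move=> t It i j; under eq_fun do rewrite mxE.
rewrite -[B t i j]add0r; apply: is_derive_withinD.
  exact: is_derive_within_cst.
exact: (svalP (prim (i, j))).2.
Qed.

Lemma is_derive_within_subr_mx {R : realType} {I : set R} {m n : nat}
    {X Y : R -> 'M[R]_(m, n)} {i : 'I_m} {j : 'I_n} {t k l : R} :
  is_derive_within I (fun s => X s i j) t k ->
  is_derive_within I (fun s => Y s i j) t l ->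
  is_derive_within I (fun s => (X s - Y s) i j) t (k - l).
Proof.
rewrite (_ : (fun s => (X s - Y s) i j) = fun s => X s i j - Y s i j).
  exact: is_derive_withinB.
by apply/funext => s; rewrite !mxE.
Qed.

Lemma mulmx_entry_bound {R : realType} {m n p : nat} {A : 'M[R]_(m, n)}
    {B : 'M[R]_(n, p)} {c : R} :
  0 <= c -> (forall i j, `|B i j| <= c) ->
  forall i j, `|(A *m B) i j| <= (\sum_k \sum_l `|A k l|) * c.
Proof.
move=> c0 Bc i j; rewrite mxE (le_trans (ler_norm_sum _ _ _))//.
apply: (@le_trans _ _ (\sum_l `|A i l| * c)).
  by apply: ler_sum => l _; rewrite normrM ler_wpM2l.
rewrite -mulr_suml ler_wpM2r//.
rewrite [leRHS](bigD1 i)//= lerDl sumr_ge0// => k _.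
exact: sumr_ge0.
Qed.

(** With [mu' = a], the function [expR (2 * mu) - expR (- (2 * mu))] has
    derivative [2 * a * expR_weight mu] and is bounded in absolute value by
    [expR_weight mu]. Hence integrating from 0 a function bounded by
    [a * (c * expR_weight mu)] yields one bounded by [c / 2 * expR_weight mu],
    on both sides of 0. *)
Definition expR_weight {R : realType} (x : R) : R :=
  expR (2 * x) + expR (- (2 * x)).

Lemma expR_weight_ge1 {R : realType} (x : R) : 1 <= expR_weight x.
Proof.
rewrite /expR_weight; have [x0|/ltW x0] := leP 0 x.
  rewrite -[1]addr0 lerD ?expR_ge0//.
  by rewrite -expR0 ler_expR mulr_ge0.
rewrite -[1]add0r lerD ?expR_ge0//.
by rewrite -expR0 ler_expR -mulrN mulr_ge0// oppr_ge0.
Qed.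

Lemma continuous_expR_weight {R : realType} : continuous (@expR_weight R).
Proof.
have c2 : continuous (fun x : R => 2 * x) by exact: mulrl_continuous.
have ep (x : R) : expR (2 * y) @[y --> x] --> expR (2 * x).
  exact: (continuous_comp (c2 x) (@continuous_expR R _)).
have en (x : R) : expR (- (2 * y)) @[y --> x] --> expR (- (2 * x)).
  exact: (continuous_comp (continuousN (c2 x)) (@continuous_expR R _)).
by move=> x; exact: cvgD (ep x) (en x).
Qed.

(** The Picard operator halves weighted norms. The weight, built on a primitive
    of the sum of the [`|A t k l|], absorbs the size of [A], which may be unbounded
    on [I]. *)
Lemma picard_contraction {R : realType} {I : set R} {m p : nat}
    {A : R -> 'M[R]_m} {mu : R -> R} {D E : R -> 'M[R]_(m, p)} {c : R} :
  is_interval I -> I 0 -> mu 0 = 0 ->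
  (forall t, I t ->
    is_derive_within I mu t (\sum_k \sum_l `|A t k l|)) ->
  0 <= c ->
  (forall t, I t -> forall i j, `|D t i j| <= c * expR_weight (mu t)) ->
  E 0 = 0 ->
  (forall t, I t -> forall i j,
    is_derive_within I (fun s => E s i j) t ((A t *m D t) i j)) ->
  forall t, I t -> forall i j, `|E t i j| <= c / 2 * expR_weight (mu t).
Proof.
move=> iI I0 mu0 dmu c0 Dc E0 dE t It i j.
pose g s := c / 2 * (expR (2 * mu s) - expR (- (2 * mu s))).
pose a s := \sum_k \sum_l `|A s k l|.
have dg s : I s -> is_derive_within I g s (a s * (c * expR_weight (mu s))).
  move=> Is.
  have d2 := is_derive_withinMl 2 (dmu s Is).
  have dp := is_derive_within_comp (is_derive_expR _) d2.
  have dn := is_derive_within_comp (is_derive_expR _)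
    (is_derive_withinMl (-1) d2).
  have := is_derive_withinMl (c / 2) (is_derive_withinB dp dn).
  rewrite /g; under eq_fun do rewrite mulN1r.
  rewrite [X in is_derive_within _ _ _ X -> _](_ : _ =
    a s * (c * expR_weight (mu s)))//.
  by rewrite /expR_weight mulN1r -/(a s); field.
have := mean_value_bound iI (fun s Is => dE s Is i j) dg _ I0 It.
rewrite E0 mxE subr0 /g mu0 mulr0 oppr0 subrr mulr0 subr0 => H.
apply: le_trans (H _) _.
  move=> s Is; apply: mulmx_entry_bound; last exact: Dc.
  by rewrite mulr_ge0// (le_trans _ (expR_weight_ge1 _)).
rewrite normrM ger0_norm ?divr_ge0// ler_wpM2l ?divr_ge0//.
apply: le_trans (ler_normB _ _) _.
by rewrite !ger0_norm ?expR_ge0.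
Qed.

(** The Picard iterates [X n] move by at most [C / 2 / 2 ^+ n] in weighted norm.
    Their limit [Q] is continuous, hence [A *m Q] has a primitive [G] with
    [G 0 = X0]; since [X n.+1 - G] has derivative [A *m (X n - Q)], the iterates
    also converge to [G]. So [Q = G], and [G] solves the equation. *)
Lemma linear_ode_solution {R : realType} {I : set R} {m p : nat}
    {A : R -> 'M[R]_m} (X0 : 'M[R]_(m, p)) :
  is_interval I -> I 0 ->
  (forall i j, {within I, continuous (fun t => A t i j)}) ->
  exists X : R -> 'M[R]_(m, p), X 0 = X0 /\
    forall t, I t -> forall i j,
      is_derive_within I (fun s => X s i j) t ((A t *m X t) i j).
Proof.
move=> iI I0 cA.
have ca : {within I, continuous (fun t => \sum_k \sum_l `|A t k l|)}.
  apply: within_continuous_sum => k; apply: within_continuous_sum => l t.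
  by apply: (continuous_comp (cA k l t)); exact: norm_continuous.
have [mu [mu0 dmu]] := ex_primitive iI I0 ca.
have contr D E c := @picard_contraction R I m p A mu D E c iI I0 mu0 dmu.
have /choice [prim primP] := fun B => @ex_primitive_mx R I m p X0 B iI I0.
pose X n := iter n (fun Y => prim (fun t => A t *m Y t)) (fun=> X0).
have cX n : forall i j, {within I, continuous (fun t => X n t i j)}.
  elim: n => [|n IH] i j; first by move=> t; exact: cvg_cst.
  have [_ dX] := primP _ (within_continuous_mulmx cA IH).
  by apply: derive_within_continuous => t It; exact: dX.
have XS n : X n.+1 0 = X0 /\ forall t, I t -> forall i j,
    is_derive_within I (fun s => X n.+1 s i j) t ((A t *m X n t) i j).
  exact: primP _ (within_continuous_mulmx cA (cX n)).
have X00 n : X n 0 = X0 by case: n => [//|n]; exact: (XS n).1.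
pose C := \sum_i \sum_j `|X0 i j|.
have C0 : 0 <= C by apply: sumr_ge0 => i _; exact: sumr_ge0.
have X0C i j : `|X0 i j| <= C.
  rewrite /C (bigD1 i)//= (bigD1 j)//= -addrA lerDl.
  rewrite addr_ge0// sumr_ge0// => k _.
  exact: sumr_ge0.
pose w t := expR_weight (mu t).
have w0 t : 0 <= w t by exact: le_trans (expR_weight_ge1 _).
have cw : {within I, continuous w}.
  have cmu := derive_within_continuous dmu.
  by move=> t; exact: (continuous_comp (cmu t) (@continuous_expR_weight R _)).
have dXX n t : I t -> forall i j,
    `|X n.+1 t i j - X n t i j| <= C / 2 / 2 ^+ n * w t.
  elim: n t => [|n IH] t It i j.
    (* X 1 - X 0 is the integral of A *m X0, and the weight is at least 1. *)
    have := contr (fun=> X0) (fun s => X 1 s - X0) C C0 _ _ _ t It i j.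
    rewrite !mxE expr0 divr1; apply => [s Is k l||s Is k l].
    - by rewrite (le_trans (X0C k l))// ler_peMr// expR_weight_ge1.
    - by rewrite X00 subrr.
    - rewrite -[(A s *m X0) k l]subr0; apply: is_derive_within_subr_mx.
        exact: (XS 0).2.
      exact: is_derive_within_cst.
  rewrite exprSr invfM mulrA.
  have := contr (fun s => X n.+1 s - X n s) (fun s => X n.+2 s - X n.+1 s)
    (C / 2 / 2 ^+ n) _ _ _ _ t It i j.
  rewrite !mxE; apply.
  - by rewrite !divr_ge0.
  - by move=> s Is k l; rewrite !mxE; exact: IH.
  - by rewrite !X00 subrr.
  - move=> s Is k l; rewrite mulmxBr [X in is_derive_within _ _ _ X]mxE.
    rewrite [X in _ + X]mxE.
    exact: is_derive_within_subr_mx ((XS n.+1).2 s Is k l) ((XS n).2 s Is k l).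
have QP (q : R * ('I_m * 'I_p)) : {l : R | I q.1 ->
    forall n, `|l - X n q.1 q.2.1 q.2.2| <= C / 2 ^+ n * w q.1}.
  apply: cid; have [Iq|nIq] := pselect (I q.1); last by exists 0.
  have [|l Hl] := @geometric_steps_limit R
    (fun n => X n q.1 q.2.1 q.2.2) (C * w q.1).
    move=> n; apply: le_trans (dXX n q.1 Iq q.2.1 q.2.2) _.
    by rewrite le_eqVlt; apply/orP; left; apply/eqP; ring.
  exists l => _ n; apply: le_trans (Hl n) _.
  by rewrite mulrAC.
pose Q t := \matrix_(i, j) sval (QP (t, (i, j))).
have QX n t : I t -> forall i j, `|Q t i j - X n t i j| <= C / 2 ^+ n * w t.
  by move=> It i j; rewrite mxE; exact: (svalP (QP (t, (i, j)))).
have cQ i j : {within I, continuous (fun t => Q t i j)}.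
  apply: (within_continuous_geometric_limit (fun n => cX n i j) cw _ C0).
  by move=> n t It; exact: QX.
have [G0 dG] := primP _ (within_continuous_mulmx cA cQ).
set G := prim _ in G0 dG.
suff GQ t : I t -> G t = Q t.
  by exists G; split=> // t It i j; rewrite GQ//; exact: dG.
move=> It; apply/matrixP => i j.
have GX n : `|X n.+1 t i j - G t i j| <= C / 2 ^+ n / 2 * w t.
  have := contr (fun s => X n s - Q s) (fun s => X n.+1 s - G s)
    (C / 2 ^+ n) _ _ _ _ t It i j.
  rewrite !mxE; apply.
  - by rewrite !divr_ge0// exprn_ge0.
  - move=> s Is k l; rewrite [X in `|X|]mxE [X in _ + X]mxE distrC.
    exact: QX.
  - by rewrite X00 G0 subrr.
  - move=> s Is k l; rewrite mulmxBr [X in is_derive_within _ _ _ X]mxE.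
    rewrite [X in _ + X]mxE.
    exact: is_derive_within_subr_mx ((XS n).2 s Is k l) (dG s Is k l).
have GQn n : `|G t i j - Q t i j| <= C * w t / 2 ^+ n.
  have := ler_distD (X n.+1 t i j) (G t i j) (Q t i j).
  have := QX n.+1 t It i j; have := GX n; rewrite exprS invfM => h1 h2 h3.
  move: h1 h2 h3; rewrite (distrC (Q t i j)) (distrC (X n.+1 t i j) (G t i j)).
  have -> : C / 2 ^+ n / 2 * w t = C * w t / 2 ^+ n / 2 by ring.
  have -> : C * (2^-1 / 2 ^+ n) * w t = C * w t / 2 ^+ n / 2 by ring.
  by lra.
apply/eqP; rewrite -subr_eq0 -normr_le0 leNgt; apply/negP => gt0.
have [n] := div_exp2_lt (C * w t) _ gt0.
by rewrite ltNge GQn.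
Qed.

(** * Vector calculus in three-space *)

(** Names for the three coordinates: the triple products and the Jacobi identity
    are checked below as polynomial identities in coordinates. *)
Definition ix : 'I_3 := 0.
Definition iy : 'I_3 := 1.
Definition iz : 'I_3 := 2.

Lemma ord3P (P : 'I_3 -> Prop) : P ix -> P iy -> P iz -> forall i, P i.
Proof.
by move=> Px Py Pz [[|[|[|//]]] lti];
  [move: Px|move: Py|move: Pz]; congr P; exact: val_inj.
Qed.

Lemma dotprodE {R : realType} (u v : 'cV[R]_3) :
  dotprod u v = u ix 0 * v ix 0 + u iy 0 * v iy 0 + u iz 0 * v iz 0.
Proof.
rewrite /dotprod !big_ord_recr big_ord0 /= add0r.
by congr (u _ _ * v _ _ + u _ _ * v _ _ + u _ _ * v _ _); exact: val_inj.
Qed.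

Lemma crossprod_x {R : realType} (u v : 'cV[R]_3) :
  (u *v v) ix 0 = u iy 0 * v iz 0 - u iz 0 * v iy 0.
Proof.
by rewrite mxE; congr (u _ _ * v _ _ - u _ _ * v _ _); exact: val_inj.
Qed.

Lemma crossprod_y {R : realType} (u v : 'cV[R]_3) :
  (u *v v) iy 0 = u iz 0 * v ix 0 - u ix 0 * v iz 0.
Proof.
by rewrite mxE; congr (u _ _ * v _ _ - u _ _ * v _ _); exact: val_inj.
Qed.

Lemma crossprod_z {R : realType} (u v : 'cV[R]_3) :
  (u *v v) iz 0 = u ix 0 * v iy 0 - u iy 0 * v ix 0.
Proof.
by rewrite mxE; congr (u _ _ * v _ _ - u _ _ * v _ _); exact: val_inj.
Qed.

Definition crossprodE {R : realType} :=
  (@crossprod_x R, @crossprod_y R, @crossprod_z R).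

Lemma addcE {R : realType} (u v : 'cV[R]_3) i : (u + v) i 0 = u i 0 + v i 0.
Proof. by rewrite mxE. Qed.

Lemma oppcE {R : realType} (u : 'cV[R]_3) i : (- u) i 0 = - u i 0.
Proof. by rewrite mxE. Qed.

Lemma scalecE {R : realType} (a : R) (u : 'cV[R]_3) i :
  (a *: u) i 0 = a * u i 0.
Proof. by rewrite mxE. Qed.

Definition coordE {R : realType} :=
  (@dotprodE R, @crossprodE R, @addcE R, @oppcE R, @scalecE R).

Lemma col3P {R : realType} (u v : 'cV[R]_3) :
  u ix 0 = v ix 0 -> u iy 0 = v iy 0 -> u iz 0 = v iz 0 -> u = v.
Proof. by move=> x y z; apply/colP; exact: ord3P. Qed.

Lemma is_derive_within_coord {R : realType} {A : set R} {u : R -> 'cV[R]_3}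
    {t : R} {u' : 'cV[R]_3} i :
  is_derive_within A u t u' -> is_derive_within A (fun s => u s i 0) t (u' i 0).
Proof. by move=> /is_derive_within_mxP. Qed.

Lemma is_derive_within_dotprod {R : realType} {A : set R}
    {u v : R -> 'cV[R]_3} {t : R} {u' v' : 'cV[R]_3} :
  is_derive_within A u t u' -> is_derive_within A v t v' ->
  is_derive_within A (fun s => dotprod (u s) (v s)) t
    (dotprod u' (v t) + dotprod (u t) v').
Proof.
move=> /is_derive_within_mxP du /is_derive_within_mxP dv.
rewrite /dotprod -big_split /=; apply: is_derive_within_sum => i.
exact: is_derive_withinM.
Qed.

Lemma is_derive_within_crossprod {R : realType} {A : set R}
    {u v : R -> 'cV[R]_3} {t : R} {u' v' : 'cV[R]_3} :
  is_derive_within A u t u' -> is_derive_within A v t v' ->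
  is_derive_within A (fun s => u s *v v s) t (u' *v v t + u t *v v').
Proof.
move=> /is_derive_within_mxP du /is_derive_within_mxP dv.
apply/is_derive_within_mxP => i j; under eq_fun do rewrite mxE.
rewrite !mxE addrACA -opprD.
by apply: is_derive_withinB; exact: is_derive_withinM.
Qed.

Lemma is_derive_within_mulmxr {R : realType} {A : set R} {m n p : nat}
    {M : R -> 'M[R]_(m.+1, n.+1)} {t : R} {D : 'M[R]_(m.+1, n.+1)}
    (c : 'M[R]_(n.+1, p.+1)) :
  is_derive_within A M t D ->
  is_derive_within A (fun s => M s *m c) t (D *m c).
Proof.
move=> /is_derive_within_mxP dM; apply/is_derive_within_mxP => i j.
rewrite mxE; under eq_fun do rewrite mxE.
apply: is_derive_within_sum => k.
have := is_derive_withinM (dM i k) (is_derive_within_cst A (c k j) t).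
by rewrite mulr0 addr0.
Qed.

Lemma enormE {R : realType} (u : 'cV[R]_3) : enorm u ^+ 2 = dotprod u u.
Proof.
by rewrite sqr_sqrtr// dotprodE -!expr2 !addr_ge0// sqr_ge0.
Qed.

Lemma dotprod_eq0 {R : realType} (u : 'cV[R]_3) : dotprod u u = 0 -> u = 0.
Proof.
rewrite dotprodE -!expr2 => /eqP.
rewrite !paddr_eq0 ?addr_ge0 ?sqr_ge0// !sqrf_eq0 => /andP[/andP[]].
by move=> /eqP x /eqP y /eqP z; apply: col3P; rewrite mxE.
Qed.

Lemma is_derive_within_enorm {R : realType} {A : set R} {u : R -> 'cV[R]_3}
    {t : R} {u' : 'cV[R]_3} :
  u t != 0 -> is_derive_within A u t u' ->
  is_derive_within A (fun s => enorm (u s)) t (dotprod (u t) u' / enorm (u t)).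
Proof.
move=> ut0 du.
have dot_gt0 : 0 < dotprod (u t) (u t).
  rewrite lt_neqAle -enormE sqr_ge0 andbT eq_sym enormE.
  by apply: contra_neq ut0; exact: dotprod_eq0.
have := is_derive_within_comp (is_derive1_sqrt dot_gt0)
  (is_derive_within_dotprod du du).
congr is_derive_within; rewrite -/(enorm (u t)).
have n0 : enorm (u t) != 0 by rewrite gt_eqF// sqrtr_gt0.
rewrite !dotprodE; field; exact: n0.
Qed.

(** Since [rotation_mx_neg] is a choice among the solutions, this is what gives
    it a meaning. *)
Lemma rotation_ivp_ex {R : realType} {I : set R} {w : R -> 'cV[R]_3} :
  time_interval I -> (forall t, I t -> derivable_within I w t) ->
  exists Q, rotation_ivp I w Q.
Proof.
move=> tI dw; have [iI I0 _] := tI.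
have [|Q [Q0 dQ]] := @linear_ode_solution R I 3 3
  (fun t => - skew_mx (w t)) 1%:M iI I0.
  move=> i j; under eq_fun do rewrite !mxE opprB.
  apply: (derive_within_continuous (fun t It => is_derive_withinB
    (is_derive_withinM (is_derive_within_coord _ (derivable_withinP (dw t It)))
      (is_derive_within_cst I _ t))
    (is_derive_withinM (is_derive_within_coord _ (derivable_withinP (dw t It)))
      (is_derive_within_cst I _ t)))).
exists Q; split=> // t It; apply: derive_withinE => //.
by apply/is_derive_within_mxP; exact: dQ.
Qed.

(** The vector [w *v M] is orthogonal to [M], so the length of [M] is
    constant. *)
Lemma rotating_flow_unique {R : realType} {J : set R}
    {w M : R -> 'cV[R]_3} :
  is_interval J -> J 0 ->
  (forall t, J t -> is_derive_within J M t (- (w t *v M t))) ->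
  M 0 = 0 -> forall t, J t -> M t = 0.
Proof.
move=> iJ J0 dM M0 t Jt; apply: dotprod_eq0.
rewrite -[RHS](_ : dotprod (M 0) (M 0) = 0); last first.
  by rewrite M0 dotprodE !mxE; ring.
apply: (derive_within0_cst (g := fun s => dotprod (M s) (M s)) iJ) => // s Js.
have := is_derive_within_dotprod (dM s Js) (dM s Js).
by congr is_derive_within; rewrite !coordE; ring.
Qed.

Theorem mainTheorem17 (R : realType) (I : set R) (omega : R -> 'cV[R]_3)
  (f F : R -> R) (r0 v0 : 'cV[R]_3)
  (hI : time_interval I)
  (homega : forall t, I t -> derivable_within I omega t)
  (hF : antiderivative_pos f F)
  (hf : inertial_well_posed f) :
  forall (J : set R) (r : R -> 'cV[R]_3),
    time_interval J -> J `<=` I ->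
    cauchy_solution I omega f r0 v0 J r ->
    let dr := derive_within J r in
    let Omega0 := r0 *v (v0 + omega 0 *v r0) in
    (exists c : R, forall t, J t ->
       enorm (dr t) ^+ 2 / 2 + triple (omega t) (r t) (dr t)
         + 1 / 2 * enorm (omega t *v r t) ^+ 2 + F (enorm (r t)) = c) /\
    (forall t, J t ->
       r t *v (dr t + omega t *v r t)
         = rotation_tensor_neg I omega (fun=> Omega0) t).
Proof.
move=> J r hJ JI [r_neq0 r_der dr_der eqm [r_0 dr_0]] dr Omega0.
have [iJ J0 _] := hJ.
have Dr t : J t -> is_derive_within J r t (dr t) by move=> /r_der.
have Ddr t : J t -> is_derive_within J dr t (derive_within J dr t).
  by move=> /dr_der.
have Dw t : J t -> is_derive_within J omega t (derive_within I omega t).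
  by move=> /JI It; apply: is_derive_withinS JI _; exact: homega.
pose u t := dr t + omega t *v r t.
pose k t := f (enorm (r t)) / enorm (r t).
have Du t : J t -> is_derive_within J u t (- (omega t *v u t) - k t *: r t).
  move=> Jt; have := is_derive_withinD (Ddr t Jt)
    (is_derive_within_crossprod (Dw t Jt) (Dr t Jt)).
  (* The difference of the two sides is the left-hand side of the equation. *)
  congr is_derive_within; apply/eqP; rewrite -subr_eq0 -(eqm t Jt); apply/eqP.
  rewrite -/dr /u; apply: col3P; rewrite !coordE /k; ring.
split.
  pose E t := dotprod (u t) (u t) / 2 + F (enorm (r t)).
  have DE t : J t -> is_derive_within J E t 0.
    move=> Jt.
    have n0 : 0 < enorm (r t).
      rewrite lt_neqAle sqrtr_ge0 andbT eq_sym; apply: contra_neq (r_neq0 t Jt).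
      by move=> n0; apply: dotprod_eq0; rewrite -enormE n0 expr0n.
    have DF := is_derive_within_comp (g := fun s => enorm (r s)) (hF _ n0)
      (is_derive_within_enorm (r_neq0 t Jt) (Dr t Jt)).
    have := is_derive_withinD (is_derive_withinM (is_derive_within_dotprod
      (Du t Jt) (Du t Jt)) (is_derive_within_cst J (2^-1 : R) t)) DF.
    congr is_derive_within; rewrite /k /u !coordE; field; exact: lt0r_neq0.
  exists (E 0) => t Jt; rewrite -(derive_within0_cst iJ DE Jt J0) /E /u.
  by congr (_ + _); rewrite !enormE /triple !coordE; field.
have [Q0 dQ] := getPex (rotation_ivp_ex hI homega).
move=> t Jt; apply/eqP; rewrite -subr_eq0; apply/eqP.
rewrite /rotation_tensor_neg.
apply: (rotating_flow_unique (w := omega) (M := fun t => r t *v u t -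
  rotation_mx_neg I omega t *m Omega0) iJ J0) => // [s Js|].
  have [/derivable_withinP dQs Qs] := dQ s (JI s Js).
  rewrite Qs in dQs.
  have {}dQs := is_derive_within_mulmxr Omega0 (is_derive_withinS JI dQs).
  have DL := is_derive_within_crossprod (Dr s Js) (Du s Js).
  rewrite -mulmxA mulNmx skew_mxE in dQs.
  apply/is_derive_within_mxP => i j; rewrite (ord1 j).
  under eq_fun do rewrite addcE oppcE.
  have := is_derive_withinB (is_derive_within_coord i DL)
    (is_derive_within_coord i dQs).
  rewrite -/(rotation_mx_neg I omega).
  set q := rotation_mx_neg I omega s *m Omega0.
  (* In each coordinate, this is the Jacobi identity. *)
  congr is_derive_within; move: i; apply: ord3P; rewrite /u !coordE; ring.
by rewrite [rotation_mx_neg I omega 0]Q0 mul1mx /u r_0 /dr dr_0 subrr.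
Qed.
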